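(* In $\mathbf{ZF}$, each of the following statements implies the one beneath it: (a) $\mathbf{CMC}(\aleph_0,\infty)$: for every countable family $\mathcal{F}$ of non-empty sets there is a function $f$ on $\mathcal{F}$ such that, for every $x\in\mathcal{F}$, $f(x)$ is a non-empty countable subset of $x$; (b) for every infinite set $X$ and every bornology $\mathcal{Z}$ on $X$, if $\mathcal{Z}$ is a $\sigma$-ideal, then $2^X[\mathcal{Z}]$ and $\mathbf{S}_{\mathcal{P}}(X,\mathcal{Z})$ are both $P$-spaces; (c) for every infinite set $X$ and every bornology $\mathcal{Z}$ on $X$, if $\mathcal{Z}$ is a $\sigma$-ideal, then $\mathbf{S}(X,\mathcal{Z})$ is a $P$-space.
   Context: The background theory is $\mathbf{ZF}$ (no axiom of choice). $[X]^{<\omega}$ is the set of finite subsets of $X$. A bornology on $X$ is an ideal $\mathcal{I}$ of subsets of $X$ (closed under subsets and finite unions, possibly improper) with $\bigcup\mathcal{I}=X$; a $\sigma$-ideal is an ideal closed under unions of sequences indexed by $\omega$. For $\mathcal{A}\subseteq\mathcal{P}(X)$, $\mathbf{S}_{\mathcal{A}}(X,\mathcal{Z})$ is the set $\mathcal{A}$ with the topology consisting of all $V\subseteq\mathcal{A}$ such that for every $x\in V$ there is $z\in\mathcal{Z}$ with $x\cap z=\emptyset$ and $\{y\in\mathcal{A}:x\subseteq y\subseteq X\setminus z\}\subseteq V$. $\mathbf{S}_{\mathcal{P}}(X,\mathcal{Z})=\mathbf{S}_{\mathcal{P}(X)}(X,\mathcal{Z})$, $\mathbf{S}(X,\mathcal{Z})=\mathbf{S}_{[X]^{<\omega}}(X,\mathcal{Z})$.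 $2=\{0,1\}$. For $z\in\mathcal{Z}\setminus\{\emptyset\}$ and $p\in 2^z$, $[p]_X=\{f\in 2^X:p\subseteq f\}$. $2^X[\mathcal{Z}]$ is the set $2^X$ with the topology $\{V\subseteq 2^X:(\forall f\in V)(\exists z\in\mathcal{Z}\setminus\{\emptyset\})(\exists p\in 2^z)\ f\in[p]_X\subseteq V\}$. A $P$-space is a topological space in which every $G_\delta$-set (countable intersection of open sets) is open. *)

(* Defs.v *)
(* ZF is taken as the first-order theory: a statement is asserted "in ZF" by
   asserting it in every model of ZF.  The metatheory may be classical and may
   even have choice; since Separation and Replacement are required only for
   first-order formulas with parameters, no choice is thereby available inside
   the model. *)

Set Implicit Arguments.
Unset Strict Implicit.

Record set_structure : Type := SetStructure {
  carrier :> Type;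
  mem : carrier -> carrier -> Prop
}.

Declare Scope zf_scope.
Delimit Scope zf_scope with zf.
Notation "x ∈ y" := (mem x y) (at level 70, no associativity) : zf_scope.
Notation "x ∉ y" := (~ mem x y) (at level 70, no associativity) : zf_scope.
Open Scope zf_scope.

(* De Bruijn indices: a quantifier binds the variable 0 of its body. *)
Inductive formula : Type :=
| FMem (i j : nat)
| FEq (i j : nat)
| FFalse
| FImp (p q : formula)
| FAnd (p q : formula)
| FOr (p q : formula)
| FAll (p : formula)
| FEx (p : formula).

Definition scons {T : Type} (x : T) (e : nat -> T) : nat -> T :=
  fun n => match n with O => x | S k => e k end.

Fixpoint sat (M : set_structure) (e : nat -> M) (p : formula) : Prop :=
  match p with
  | FMem i j => e i ∈ e j
  | FEq i j => e i = e j
  | FFalse => False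
  | FImp p q => sat e p -> sat e q
  | FAnd p q => sat e p /\ sat e q
  | FOr p q => sat e p \/ sat e q
  | FAll p => forall x : M, sat (scons x e) p
  | FEx p => exists x : M, sat (scons x e) p
  end.

Definition subset (M : set_structure) (a b : M) : Prop :=
  forall x, x ∈ a -> x ∈ b.
Notation "a ⊆ b" := (subset a b) (at level 70, no associativity) : zf_scope.

Definition is_empty (M : set_structure) (a : M) : Prop := forall x, x ∉ a.

Definition nonempty (M : set_structure) (a : M) : Prop := exists x, x ∈ a.

Definition disjoint (M : set_structure) (a b : M) : Prop :=
  forall x, ~ (x ∈ a /\ x ∈ b).

Definition is_upair (M : set_structure) (w a b : M) : Prop :=
  forall x, x ∈ w <-> x = a \/ x = b.

Definition is_union (M : set_structure) (u s : M) : Prop :=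
  forall x, x ∈ u <-> exists y, y ∈ s /\ x ∈ y.

Definition is_succ (M : set_structure) (s n : M) : Prop :=
  forall x, x ∈ s <-> x ∈ n \/ x = n.

Definition inductive_set (M : set_structure) (w : M) : Prop :=
  (exists e, is_empty e /\ e ∈ w) /\
  (forall n, n ∈ w -> exists s, is_succ s n /\ s ∈ w).

Record is_ZF_model (M : set_structure) : Prop := IsZFModel {
  zf_extensionality : forall a b : M, (forall x, x ∈ a <-> x ∈ b) -> a = b;
  zf_foundation : forall a : M, nonempty a -> exists x, x ∈ a /\ disjoint x a;
  zf_pairing : forall a b : M, exists w, is_upair w a b;
  zf_union : forall s : M, exists u, is_union u s;
  zf_power : forall a : M, exists b, forall x, x ∈ b <-> x ⊆ a;
  zf_infinity : exists w : M, inductive_set w;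
  zf_separation : forall (p : formula) (e : nat -> M) (a : M),
    exists b, forall x, x ∈ b <-> x ∈ a /\ sat (scons x e) p;
  zf_replacement : forall (p : formula) (e : nat -> M) (a : M),
    (forall x y y', x ∈ a ->
       sat (scons x (scons y e)) p -> sat (scons x (scons y' e)) p -> y = y') ->
    exists b, forall y, y ∈ b <-> exists x, x ∈ a /\ sat (scons x (scons y e)) p
}.

(* Below, an argument of type [M -> Prop] is a class of M, used for definite
   sets such as ω or P(X) so that they can be written as class terms; every
   class to which these definitions are applied in the end is given by a
   first-order condition with parameters in M. *)

(* Kuratowski pair: p = {{a}, {a, b}} *)
Definition is_pair (M : set_structure) (p a b : M) : Prop :=
  forall w, w ∈ p <-> is_upair w a a \/ is_upair w a b.

Definition app (M : set_structure) (f x y : M) : Prop :=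
  exists p, is_pair p x y /\ p ∈ f.

Definition function_on (M : set_structure) (f a : M) : Prop :=
  (forall p, p ∈ f -> exists x y, x ∈ a /\ is_pair p x y) /\
  (forall x, x ∈ a -> exists! y, app f x y).

Definition maps (M : set_structure) (f a : M) (B : M -> Prop) : Prop :=
  function_on f a /\ (forall x y, app f x y -> B y).

Definition injective (M : set_structure) (f : M) : Prop :=
  forall x x' y, app f x y -> app f x' y -> x = x'.

Definition bijection (M : set_structure) (f a b : M) : Prop :=
  maps f a (fun y => y ∈ b) /\ injective f /\
  (forall y, y ∈ b -> exists x, app f x y).

(* the class term for ω, the least inductive set *)
Definition omega (M : set_structure) (n : M) : Prop :=
  forall w, inductive_set w -> n ∈ w.

Definition finite (M : set_structure) (a : M) : Prop :=
  exists n f, omega n /\ bijection f a n.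

Definition infinite (M : set_structure) (a : M) : Prop := ~ finite a.

Definition countable (M : set_structure) (a : M) : Prop :=
  exists f, maps f a (@omega M) /\ injective f.

Definition CMC (M : set_structure) : Prop :=
  forall F : M, countable F -> (forall x, x ∈ F -> nonempty x) ->
    exists f, function_on f F /\
      forall x y, x ∈ F -> app f x y -> nonempty y /\ y ⊆ x /\ countable y.

Definition ideal (M : set_structure) (X I : M) : Prop :=
  (forall a, a ∈ I -> a ⊆ X) /\
  (exists e, is_empty e /\ e ∈ I) /\
  (forall a b, a ∈ I -> b ⊆ a -> b ∈ I) /\
  (forall a b, a ∈ I -> b ∈ I ->
     exists u, u ∈ I /\ forall x, x ∈ u <-> x ∈ a \/ x ∈ b).

Definition bornology (M : set_structure) (X I : M) : Prop :=
  ideal X I /\ is_union X I.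

Definition sigma_ideal (M : set_structure) (X I : M) : Prop :=
  ideal X I /\
  forall w s, (forall n, n ∈ w <-> omega n) -> maps s w (fun a => a ∈ I) ->
    exists u, u ∈ I /\
      forall x, x ∈ u <-> exists n a, app s n a /\ x ∈ a.

(* The third clause makes the class Y a set of M. *)
Definition topology (M : set_structure) (Y Open : M -> Prop) : Prop :=
  (forall V, Open V -> forall x, x ∈ V -> Y x) /\
  (exists V, Open V /\ is_empty V) /\
  (exists V, Open V /\ forall x, x ∈ V <-> Y x) /\
  (forall V V', Open V -> Open V' ->
     exists W, Open W /\ forall x, x ∈ W <-> x ∈ V /\ x ∈ V') /\
  (forall S, (forall V, V ∈ S -> Open V) -> exists U, Open U /\ is_union U S).

(* The intersection is taken in the whole space, which matters only for the
   empty family. *)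
Definition G_delta (M : set_structure) (Y Open : M -> Prop) (G : M) : Prop :=
  exists U, countable U /\ (forall V, V ∈ U -> Open V) /\
    forall x, x ∈ G <-> Y x /\ forall V, V ∈ U -> x ∈ V.

Definition P_space (M : set_structure) (Y Open : M -> Prop) : Prop :=
  topology Y Open /\ forall G, G_delta Y Open G -> Open G.

Definition power_set (M : set_structure) (X x : M) : Prop := x ⊆ X.

Definition finite_subsets (M : set_structure) (X x : M) : Prop :=
  x ⊆ X /\ finite x.

(* the open sets of S_A(X, Z) *)
Definition S_open (M : set_structure) (A : M -> Prop) (X Z V : M) : Prop :=
  (forall x, x ∈ V -> A x) /\
  forall x, x ∈ V -> exists z, z ∈ Z /\ disjoint x z /\
    forall y, A y -> x ⊆ y -> (forall t, t ∈ y -> t ∈ X /\ t ∉ z) -> y ∈ V.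

(* 2 = {0, 1}, with 0 = ∅ and 1 = {∅} *)
Definition two (M : set_structure) (i : M) : Prop :=
  is_empty i \/ (forall j, j ∈ i <-> is_empty j).

Definition two_power (M : set_structure) (X f : M) : Prop :=
  maps f X (@two M).

Definition cylinder (M : set_structure) (X p f : M) : Prop :=
  two_power X f /\ p ⊆ f.

(* the open sets of 2^X[Z] *)
Definition two_power_open (M : set_structure) (X Z V : M) : Prop :=
  (forall f, f ∈ V -> two_power X f) /\
  forall f, f ∈ V -> exists z p, z ∈ Z /\ nonempty z /\ two_power z p /\
    cylinder X p f /\ (forall g, cylinder X p g -> g ∈ V).

Definition P_spaces_two_power_and_SP (M : set_structure) : Prop :=
  forall X Z : M, infinite X -> bornology X Z -> sigma_ideal X Z ->
    P_space (two_power X) (two_power_open X Z) /\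
    P_space (power_set X) (S_open (power_set X) X Z).

Definition P_spaces_S (M : set_structure) : Prop :=
  forall X Z : M, infinite X -> bornology X Z -> sigma_ideal X Z ->
    P_space (finite_subsets X) (S_open (finite_subsets X) X Z).

(* Main.v *)
(** The heart is (a) implies (b).  Let x lie in G, the intersection of a
   countable family U of open sets.  For V in U let F_V be the set of all pairs
   (V, z) such that z in Z witnesses that V is a neighbourhood of x; tagging z
   with V makes V |-> F_V injective, so that {F_V : V in U} is countable.  CMC
   gives countable non-empty C_V, a subset of F_V.  A countable union of
   countable sets need not be countable in ZF, but Z is a sigma-ideal: for each
   V the union u_V of the second coordinates of C_V is in Z, hence so is the
   union u of all the u_V, and u witnesses that G is a neighbourhood of x.

   For (b) implies (c), if A is a set of subsets of X, then every open subset V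
   of S_A(X, Z) is the trace on A of the open subset
   V' = {y : for some z in Z disjoint from y, all y' in A with y included in y'
   and y' disjoint from z lie in V} of S_P(X, Z).  The map V |-> V' is injective,
   so G_delta-sets of S_A(X, Z) are traces of G_delta-sets of S_P(X, Z). *)

From Stdlib Require Import Classical Arith Lia.
Require Import Defs.

(** * Separation for predicates with parameters *)

Fixpoint rename (r : nat -> nat) (p : formula) : formula :=
  let up := fun n => match n with O => O | S k => S (r k) end in
  match p with
  | FMem i j => FMem (r i) (r j)
  | FEq i j => FEq (r i) (r j)
  | FFalse => FFalse
  | FImp p q => FImp (rename r p) (rename r q)
  | FAnd p q => FAnd (rename r p) (rename r q)
  | FOr p q => FOr (rename r p) (rename r q)
  | FAll p => FAll (rename up p)
  | FEx p => FEx (rename up p)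
  end.

Lemma sat_rename (M : set_structure) (p : formula) :
  forall (r : nat -> nat) (e e' : nat -> M),
    (forall n, e n = e' (r n)) -> (sat e p <-> sat e' (rename r p)).
Proof.
  induction p as [i j|i j| |p IHp q IHq|p IHp q IHq|p IHp q IHq|p IHp|p IHp];
    intros r e e' H; simpl.
  - now rewrite (H i), (H j).
  - now rewrite (H i), (H j).
  - tauto.
  - specialize (IHp r e e' H); specialize (IHq r e e' H); tauto.
  - specialize (IHp r e e' H); specialize (IHq r e e' H); tauto.
  - specialize (IHp r e e' H); specialize (IHq r e e' H); tauto.
  - split; intros Hs x; generalize (Hs x); apply IHp; intros [|n]; simpl; auto.
  - split; intros [x Hs]; exists x; revert Hs; apply IHp; intros [|n]; simpl; auto.
Qed.

(* The variables sit at the even indices and the parameters at the odd ones, so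
   that both supplies are infinite. *)
Definition interleave {T : Type} (e c : nat -> T) (n : nat) : T :=
  if Nat.even n then e (Nat.div2 n) else c (Nat.div2 n).

Lemma interleave_even {T : Type} (e c : nat -> T) (k : nat) :
  interleave e c (2 * k) = e k.
Proof.
  unfold interleave. now rewrite Nat.even_even, Nat.div2_double.
Qed.

Lemma interleave_odd {T : Type} (e c : nat -> T) (k : nat) :
  interleave e c (2 * k + 1) = c k.
Proof.
  unfold interleave. rewrite Nat.even_odd.
  replace (2 * k + 1) with (S (2 * k)) by lia.
  now rewrite Nat.div2_succ_double.
Qed.

(** Two parameter sequences are merged into one by [interleave c c']. The parameter [c k], at index
    n = 2k+1, moves to 2(2k)+1 = 2n-1; [merge_right] sends [c' k] to 2(2k+1)+1 = 2n+1. Variables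
    stay at their even indices. *)
Definition merge_left (n : nat) : nat :=
  if Nat.even n then n else 2 * n - 1.

Definition merge_right (n : nat) : nat :=
  if Nat.even n then n else 2 * n + 1.

Lemma interleave_merge_left {T : Type} (e c c' : nat -> T) (n : nat) :
  interleave e c n = interleave e (interleave c c') (merge_left n).
Proof.
  unfold merge_left. destruct (Nat.Even_or_Odd n) as [[k ->]|[k ->]].
  - now rewrite Nat.even_even, !interleave_even.
  - rewrite Nat.even_odd, interleave_odd.
    replace (2 * (2 * k + 1) - 1) with (2 * (2 * k) + 1) by lia.
    now rewrite interleave_odd, interleave_even.
Qed.

Lemma interleave_merge_right {T : Type} (e c c' : nat -> T) (n : nat) :
  interleave e c' n = interleave e (interleave c c') (merge_right n).
Proof.
  unfold merge_right. destruct (Nat.Even_or_Odd n) as [[k ->]|[k ->]].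
  - now rewrite Nat.even_even, !interleave_even.
  - rewrite Nat.even_odd, interleave_odd.
    now rewrite !interleave_odd.
Qed.

(** Pushing x onto the variables moves them by two places in the interleaving and leaves the
    parameters fixed, whereas pushing x onto the interleaving moves everything by one. Hence old
    variables go down by one, parameters go up by one, and x stays at 0. *)
Definition bind_index (n : nat) : nat :=
  match n with O => O | S m => if Nat.even m then S n else m end.

Lemma interleave_bind {T : Type} (x : T) (e c : nat -> T) (n : nat) :
  interleave (scons x e) c n = scons x (interleave e c) (bind_index n).
Proof.
  destruct (Nat.Even_or_Odd n) as [[k ->]|[k ->]].
  - rewrite interleave_even. destruct k as [|k]; [reflexivity|].
    replace (2 * S k) with (S (2 * k + 1)) by lia. unfold bind_index.
    rewrite Nat.even_odd. replace (2 * k + 1) with (S (2 * k)) by lia.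
    cbn [scons]. now rewrite interleave_even.
  - rewrite interleave_odd. replace (2 * k + 1) with (S (2 * k)) by lia.
    unfold bind_index. rewrite Nat.even_even.
    cbn [scons]. replace (S (2 * k)) with (2 * k + 1) by lia.
    now rewrite interleave_odd.
Qed.

(* Without [inhabited M] there might be no parameter sequence at all. *)
Definition definable_term {M : set_structure} (t : (nat -> M) -> M) : Prop :=
  inhabited M -> exists i c, forall e, t e = interleave e c i.

Definition definable {M : set_structure} (P : (nat -> M) -> Prop) : Prop :=
  inhabited M -> exists p c, forall e, sat (interleave e c) p <-> P e.

Section Definability.

Context {M : set_structure}.
Implicit Types (P Q : (nat -> M) -> Prop) (t u : (nat -> M) -> M).

Lemma definable_term_var (i : nat) : definable_term (fun e : nat -> M => e i).
Proof.
  intros [x]. exists (2 * i), (fun _ => x). intros e. now rewrite interleave_even.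
Qed.

Lemma definable_term_const (c : M) : definable_term (fun _ : nat -> M => c).
Proof.
  intros _. exists (2 * 0 + 1), (fun _ => c). intros e. now rewrite interleave_odd.
Qed.

Lemma definable_mem t u :
  definable_term t -> definable_term u -> definable (fun e => t e ∈ u e).
Proof.
  intros Ht Hu HM. destruct (Ht HM) as (i & c & Hi), (Hu HM) as (j & d & Hj).
  exists (FMem (merge_left i) (merge_right j)), (interleave c d). intros e. simpl.
  now rewrite <- interleave_merge_left, <- interleave_merge_right, Hi, Hj.
Qed.

Lemma definable_eq t u :
  definable_term t -> definable_term u -> definable (fun e => t e = u e).
Proof.
  intros Ht Hu HM. destruct (Ht HM) as (i & c & Hi), (Hu HM) as (j & d & Hj).
  exists (FEq (merge_left i) (merge_right j)), (interleave c d). intros e. simpl.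
  now rewrite <- interleave_merge_left, <- interleave_merge_right, Hi, Hj.
Qed.

Lemma definable_False : definable (fun _ : nat -> M => False).
Proof.
  intros [x]. exists FFalse, (fun _ => x). intros e. reflexivity.
Qed.

(** Each formula comes with its own parameter sequence; renaming lets both read from the merged
    sequence, which is what the binary connectives require. *)
Lemma definable_common_parameters P Q :
  definable P -> definable Q -> inhabited M ->
  exists p q c, forall e,
    (sat (interleave e c) p <-> P e) /\ (sat (interleave e c) q <-> Q e).
Proof.
  intros HP HQ HM. destruct (HP HM) as (p & c & Hp), (HQ HM) as (q & d & Hq).
  exists (rename merge_left p), (rename merge_right q), (interleave c d).
  intros e. rewrite <- Hp, <- Hq. split; symmetry; apply sat_rename; intros n.
  - apply interleave_merge_left.
  - apply interleave_merge_right.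
Qed.

Lemma definable_imp P Q :
  definable P -> definable Q -> definable (fun e => P e -> Q e).
Proof.
  intros HP HQ HM.
  destruct (definable_common_parameters P Q HP HQ HM) as (p & q & c & H).
  exists (FImp p q), c. intros e. specialize (H e). simpl. tauto.
Qed.

Lemma definable_and P Q :
  definable P -> definable Q -> definable (fun e => P e /\ Q e).
Proof.
  intros HP HQ HM.
  destruct (definable_common_parameters P Q HP HQ HM) as (p & q & c & H).
  exists (FAnd p q), c. intros e. specialize (H e). simpl. tauto.
Qed.

Lemma definable_or P Q :
  definable P -> definable Q -> definable (fun e => P e \/ Q e).
Proof.
  intros HP HQ HM.
  destruct (definable_common_parameters P Q HP HQ HM) as (p & q & c & H).
  exists (FOr p q), c. intros e. specialize (H e). simpl. tauto.
Qed.

Lemma definable_bind (P : M -> (nat -> M) -> Prop) :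
  definable (fun e => P (e 0) (fun n => e (S n))) -> inhabited M ->
  exists p c, forall x e, sat (scons x (interleave e c)) p <-> P x e.
Proof.
  intros HP HM. destruct (HP HM) as (p & c & Hp).
  exists (rename bind_index p), c. intros x e.
  rewrite <- (sat_rename M p bind_index (interleave (scons x e) c)).
  - apply (Hp (scons x e)).
  - apply interleave_bind.
Qed.

Lemma definable_all (P : M -> (nat -> M) -> Prop) :
  definable (fun e => P (e 0) (fun n => e (S n))) ->
  definable (fun e => forall x, P x e).
Proof.
  intros HP HM. destruct (definable_bind P HP HM) as (p & c & Hp).
  exists (FAll p), c. intros e. simpl. split; intros H x; apply Hp, H.
Qed.

Lemma definable_ex (P : M -> (nat -> M) -> Prop) :
  definable (fun e => P (e 0) (fun n => e (S n))) ->
  definable (fun e => exists x, P x e).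
Proof.
  intros HP HM. destruct (definable_bind P HP HM) as (p & c & Hp).
  exists (FEx p), c. intros e. simpl. split; intros [x H]; exists x; apply Hp, H.
Qed.

End Definability.

Ltac definable :=
  unfold finite, bijection, injective, maps, function_on, app, omega,
    inductive_set, is_succ, is_pair, is_upair, two, is_empty, nonempty, disjoint,
    subset, unique, iff, not;
  repeat (cbv beta;
    first
      [ apply definable_term_var | apply definable_term_const
      | apply definable_mem | apply definable_eq | apply definable_False
      | assumption
      | apply definable_and | apply definable_or | apply definable_imp
      | apply definable_all | apply definable_ex ]).

(** * Elementary set theory in a model of ZF *)

Section Model.

Context {M : set_structure} (HM : is_ZF_model M).

Lemma separation (P : M -> Prop) (a : M) :
  definable (fun e => P (e 0)) -> exists b, forall x, x ∈ b <-> x ∈ a /\ P x.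
Proof.
  intros HP.
  destruct (definable_bind (fun x _ => P x) HP (inhabits a)) as (p & c & Hp).
  (* The value [a] is a dummy for the variables other than 0, on which [P] does not depend. *)
  destruct (zf_separation HM p (interleave (fun _ => a) c) a) as [b Hb].
  exists b. intros x. rewrite (Hb x), (Hp x (fun _ => a)). reflexivity.
Qed.

Lemma pair_exists (a b : M) : exists p, is_pair p a b.
Proof.
  destruct (zf_pairing HM a a) as [u Hu], (zf_pairing HM a b) as [v Hv].
  destruct (zf_pairing HM u v) as [p Hp]. exists p. intros w. rewrite (Hp w).
  split; (intros [H|H]; [left|right]).
  - now subst w.
  - now subst w.
  - apply (zf_extensionality HM). intros x. rewrite (H x), (Hu x). reflexivity.
  - apply (zf_extensionality HM). intros x. rewrite (H x), (Hv x). reflexivity.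
Qed.

Lemma pair_unique (p q a b : M) : is_pair p a b -> is_pair q a b -> p = q.
Proof.
  intros Hp Hq. apply (zf_extensionality HM). intros w.
  rewrite (Hp w), (Hq w). reflexivity.
Qed.

Lemma pair_inj (p a b a' b' : M) :
  is_pair p a b -> is_pair p a' b' -> a = a' /\ b = b'.
Proof.
  intros H H'.
  destruct (zf_pairing HM a a) as [u Hu], (zf_pairing HM a b) as [v Hv].
  destruct (zf_pairing HM a' a') as [u' Hu'], (zf_pairing HM a' b') as [v' Hv'].
  assert (Ea : a = a').
  { assert (Hup : u ∈ p) by (apply H; now left).
    apply H' in Hup. symmetry.
    destruct Hup as [Hup|Hup]; (assert (Ha : a' ∈ u) by (apply Hup; now left));
      apply Hu in Ha; tauto. }
  subst a'. split; [reflexivity|].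
  assert (Hvp : v ∈ p) by (apply H; now right).
  assert (Hvp' : v' ∈ p) by (apply H'; now right).
  apply H' in Hvp. apply H in Hvp'.
  assert (Hb : b = a \/ b = b').
  { assert (Hb : b ∈ v) by (apply Hv; now right).
    destruct Hvp as [Hvp|Hvp]; apply Hvp in Hb; tauto. }
  assert (Hb' : b' = a \/ b' = b).
  { assert (Hb' : b' ∈ v') by (apply Hv'; now right).
    destruct Hvp' as [Hvp'|Hvp']; apply Hvp' in Hb'; tauto. }
  destruct Hb, Hb'; congruence.
Qed.

Lemma union2_exists (a b : M) : exists u, forall x, x ∈ u <-> x ∈ a \/ x ∈ b.
Proof.
  destruct (zf_pairing HM a b) as [w Hw], (zf_union HM w) as [u Hu].
  exists u. intros x. rewrite (Hu x). split.
  - intros (y & Hy & Hx). apply Hw in Hy. destruct Hy; subst; auto.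
  - intros [Hx|Hx]; [exists a|exists b]; split; auto; apply Hw; auto.
Qed.

Lemma omega_exists : exists w : M, forall n, n ∈ w <-> omega n.
Proof.
  destruct (zf_infinity HM) as [w0 H0].
  destruct (separation (@omega M) w0 ltac:(definable)) as [w Hw].
  exists w. intros n. rewrite (Hw n). split; [tauto|]. intros H. split; [|exact H].
  exact (H w0 H0).
Qed.

Lemma product_exists (a b : M) :
  exists c, forall p, p ∈ c <-> exists x y, x ∈ a /\ y ∈ b /\ is_pair p x y.
Proof.
  destruct (union2_exists a b) as [u Hu].
  destruct (zf_power HM u) as [pu Hpu], (zf_power HM pu) as [ppu Hppu].
  destruct (separation
    (fun p => exists x y, x ∈ a /\ y ∈ b /\ is_pair p x y) ppu ltac:(definable))
    as [c Hc].
  exists c. intros p. rewrite (Hc p). split; [tauto|].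
  intros H. split; [|exact H]. destruct H as (x & y & Hx & Hy & Hp).
  apply Hppu. intros w Hw. apply Hpu. intros t Ht. apply Hu.
  apply Hp in Hw. destruct Hw as [Hw|Hw]; apply Hw in Ht; destruct Ht; subst; auto.
Qed.

(** In the definability hypothesis the first argument has index 1 and the second index 0: these are
    the indices of x and y under the quantifiers [exists x y], so the hypothesis closes the subgoal
    verbatim. *)
Lemma relation_exists (a b : M) (R : M -> M -> Prop) :
  definable (fun e => R (e 1) (e 0)) ->
  exists r, (forall p, p ∈ r -> exists x y, x ∈ a /\ is_pair p x y) /\
    forall x y, app r x y <-> x ∈ a /\ y ∈ b /\ R x y.
Proof.
  intros HR. destruct (product_exists a b) as [c Hc].
  destruct (separation (fun p => exists x y, is_pair p x y /\ R x y) c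
    ltac:(definable)) as [r Hr].
  exists r. split.
  - intros p Hp. apply Hr in Hp. destruct Hp as [Hp _]. apply Hc in Hp.
    destruct Hp as (x & y & Hx & _ & Hp). eauto.
  - intros x y. split.
    + intros (p & Hxy & Hp). apply Hr in Hp. destruct Hp as [Hp (x' & y' & Hp' & HR')].
      apply Hc in Hp. destruct Hp as (x'' & y'' & Hx & Hy & Hp'').
      destruct (pair_inj _ _ _ _ _ Hxy Hp'), (pair_inj _ _ _ _ _ Hxy Hp'').
      subst. auto.
    + intros (Hx & Hy & HRxy). destruct (pair_exists x y) as [p Hp].
      exists p. split; [exact Hp|]. apply Hr. split; [apply Hc|]; eauto 10.
Qed.

Lemma app_exists (f a x : M) : function_on f a -> x ∈ a -> exists y, app f x y.
Proof. intros [_ H] Hx. destruct (H x Hx) as [y [Hy _]]. eauto. Qed.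

Lemma app_domain (f a x y : M) : function_on f a -> app f x y -> x ∈ a.
Proof.
  intros [H _] (p & Hp & Hpf). destruct (H p Hpf) as (x' & y' & Hx' & Hp').
  destruct (pair_inj _ _ _ _ _ Hp Hp'). now subst.
Qed.

Lemma app_unique (f a x y y' : M) :
  function_on f a -> app f x y -> app f x y' -> y = y'.
Proof.
  intros Hf H H'. pose proof (app_domain f a x y Hf H) as Hx.
  destruct Hf as [_ Hf]. destruct (Hf x Hx) as [z [_ Hz]].
  now rewrite <- (Hz y H), <- (Hz y' H').
Qed.

Lemma function_exists (a b : M) (R : M -> M -> Prop) :
  definable (fun e => R (e 1) (e 0)) ->
  (forall x, x ∈ a -> exists y, y ∈ b /\ R x y) ->
  (forall x y y', x ∈ a -> R x y -> R x y' -> y = y') ->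
  exists f, maps f a (fun y => y ∈ b) /\
    forall x y, app f x y <-> x ∈ a /\ y ∈ b /\ R x y.
Proof.
  intros HR Htot Huniq. destruct (relation_exists a b R HR) as (f & Hf & Happ).
  exists f. split; [split; [split|]|].
  - exact Hf.
  - intros x Hx. destruct (Htot x Hx) as (y & Hy & Hxy).
    exists y. split; [now apply Happ|]. intros y' Hy'. apply Happ in Hy'.
    apply (Huniq x); tauto.
  - intros x y H. apply Happ in H. tauto.
  - exact Happ.
Qed.

Lemma countable_intro (a : M) (R : M -> M -> Prop) :
  definable (fun e => R (e 1) (e 0)) ->
  (forall x, x ∈ a -> exists n, omega n /\ R x n) ->
  (forall x n n', x ∈ a -> R x n -> R x n' -> n = n') ->
  (forall x x' n, x ∈ a -> x' ∈ a -> R x n -> R x' n -> x = x') ->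
  countable a.
Proof.
  intros HR Htot Huniq Hinj. destruct omega_exists as [w Hw].
  destruct (function_exists a w R HR) as (f & [Hf Hfw] & Happ); auto.
  - intros x Hx. destruct (Htot x Hx) as (n & Hn & Hxn). exists n.
    split; [now apply Hw|exact Hxn].
  - exists f. split; [split; [exact Hf|]|].
    + intros x n Hx. apply Hw. exact (Hfw x n Hx).
    + intros x x' n Hx Hx'. apply Happ in Hx. apply Happ in Hx'.
      apply (Hinj x x' n); tauto.
Qed.

(** * Choosing witnesses in a sigma-ideal *)

(** A sigma-ideal is closed under unions of sequences on all of ω, while here [U] merely injects
    into ω and [r] is a partial function on [U]. Reading the injection [j] backwards and filling the
    gaps with the empty set gives a sequence with the same union. *)
Lemma sigma_ideal_union (X Z U r : M) :
  sigma_ideal X Z -> countable U ->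
  (forall V a, V ∈ U -> app r V a -> a ∈ Z) ->
  (forall V a a', V ∈ U -> app r V a -> app r V a' -> a = a') ->
  exists u, u ∈ Z /\ forall x, x ∈ u <-> exists V a, V ∈ U /\ app r V a /\ x ∈ a.
Proof.
  intros [(_ & (o & Ho & HoZ) & _) Hsig] (j & [Hj Hjw] & Hinj) HrZ Hr.
  destruct omega_exists as [w Hw].
  (* The second disjunct is the default value: the empty set, at each n that is not the index of
     some V having an [r]-value. *)
  set (R := fun n a => (exists V, V ∈ U /\ app j V n /\ app r V a) \/
    (is_empty a /\ ~ exists V a', V ∈ U /\ app j V n /\ app r V a')).
  destruct (function_exists w Z R) as (s & Hs & Happ).
  - unfold R. definable.
  - intros n _.
    destruct (classic (exists V a', V ∈ U /\ app j V n /\ app r V a'))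
      as [(V & a & HV & Hn & Ha)|H].
    + exists a. split; [now apply (HrZ V)|]. left. eauto.
    + exists o. split; [exact HoZ|]. now right.
  - intros n a a' _ [(V & HV & Hn & Ha)|[Ha Hno]] [(V' & HV' & Hn' & Ha')|[Ha' Hno']].
    + rewrite (Hinj V' V n Hn' Hn) in Ha'. exact (Hr V a a' HV Ha Ha').
    + destruct Hno'. eauto.
    + destruct Hno. eauto.
    + apply (zf_extensionality HM). intros x. split; intros Hx.
      * now destruct (Ha x).
      * now destruct (Ha' x).
  - destruct (Hsig w s Hw Hs) as (u & Hu & Hux). exists u. split; [exact Hu|].
    intros x. rewrite (Hux x). split.
    + intros (n & a & Hna & Hx). apply Happ in Hna.
      destruct Hna as (_ & _ & [(V & HV & _ & Ha)|[Ha _]]); [eauto|].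
      now destruct (Ha x).
    + intros (V & a & HV & Ha & Hx).
      destruct (app_exists j U V Hj HV) as [n Hn]. exists n, a.
      split; [|exact Hx]. apply Happ. split; [|split].
      * apply Hw, (Hjw V n Hn).
      * exact (HrZ V a HV Ha).
      * left. eauto.
Qed.

(** Here [app g V z] stands for z being a witness for V. The set u consists of points of witnesses
    only, which will keep it admissible, and it includes a whole witness for each V, which will make
    its neighbourhood small enough. *)
Lemma CMC_sigma_ideal (X Z U g : M) :
  CMC M -> sigma_ideal X Z -> countable U ->
  (forall V, V ∈ U -> exists z, z ∈ Z /\ app g V z) ->
  exists u, u ∈ Z /\
    (forall t, t ∈ u -> exists V a, V ∈ U /\ app g V a /\ t ∈ a) /\
    (forall V, V ∈ U -> exists a, app g V a /\ a ⊆ u).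
Proof.
  intros HCMC HZ HU Hg.
  set (fiber := fun V F =>
    forall p, p ∈ F <-> exists z, z ∈ Z /\ app g V z /\ is_pair p V z).
  destruct (product_exists U Z) as [UZ HUZ], (zf_power HM UZ) as [PUZ HPUZ].
  destruct (separation (fun F => exists V, V ∈ U /\ fiber V F) PUZ) as [FF HFF];
    [unfold fiber; definable|].
  assert (fiber_exists : forall V, V ∈ U -> exists F, F ∈ FF /\ fiber V F).
  { intros V HV.
    destruct (separation (fun p => exists z, z ∈ Z /\ app g V z /\ is_pair p V z) UZ
      ltac:(definable)) as [F HF].
    assert (HVF : fiber V F).
    { intros p. rewrite (HF p). split; [tauto|]. intros H. split; [|exact H].
      destruct H as (z & Hz & _ & Hp). apply HUZ. eauto. }
    exists F. split; [|exact HVF]. apply HFF. split; [|eauto].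
    apply HPUZ. intros p Hp. now apply HF in Hp. }
  assert (fiber_nonempty : forall V F, V ∈ U -> fiber V F -> nonempty F).
  { intros V F HV HF. destruct (Hg V HV) as (z & Hz & Hgz).
    destruct (pair_exists V z) as [p Hp]. exists p. apply HF. eauto. }
  assert (HFFc : countable FF).
  { destruct HU as (j & [Hj Hjw] & Hinj).
    (* The index of a fiber is the [j]-index of the tag V carried by any of its members; fibers are
       non-empty, so there is such a member. *)
    apply (countable_intro FF
      (fun F n => exists V p z, p ∈ F /\ is_pair p V z /\ app j V n)).
    - definable.
    - intros F HF. apply HFF in HF. destruct HF as (_ & V & HV & HF).
      destruct (fiber_nonempty V F HV HF) as [p Hp].
      destruct (proj1 (HF p) Hp) as (z & _ & _ & Hpz).
      destruct (app_exists j U V Hj HV) as [n Hn].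
      exists n. split; [exact (Hjw V n Hn)|]. eauto 10.
    - intros F n n' HF (V & p & z & Hp & Hpz & Hn) (V' & p' & z' & Hp' & Hpz' & Hn').
      apply HFF in HF. destruct HF as (_ & W & HW & HF).
      apply HF in Hp. destruct Hp as (y & _ & _ & Hpy).
      apply HF in Hp'. destruct Hp' as (y' & _ & _ & Hpy').
      destruct (pair_inj _ _ _ _ _ Hpz Hpy), (pair_inj _ _ _ _ _ Hpz' Hpy'). subst.
      exact (app_unique j U W n n' Hj Hn Hn').
    - intros F F' n HF HF' (V & p & z & Hp & Hpz & Hn) (V' & p' & z' & Hp' & Hpz' & Hn').
      apply HFF in HF. destruct HF as (_ & W & HW & HF).
      apply HFF in HF'. destruct HF' as (_ & W' & HW' & HF').
      apply HF in Hp. destruct Hp as (y & _ & _ & Hpy).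
      apply HF' in Hp'. destruct Hp' as (y' & _ & _ & Hpy').
      destruct (pair_inj _ _ _ _ _ Hpz Hpy), (pair_inj _ _ _ _ _ Hpz' Hpy'). subst.
      rewrite (Hinj W' W n Hn' Hn) in HF'.
      apply (zf_extensionality HM). intros p0. rewrite (HF p0), (HF' p0). reflexivity. }
  destruct (HCMC FF HFFc) as (f & Hf & HfC).
  { intros F HF. apply HFF in HF. destruct HF as (_ & V & HV & HF). eauto. }
  (* [R V u] makes u the union of the witnesses chosen for V. That this union belongs to [Z] is
     established below, from the countability of [C]. *)
  set (R := fun V u => exists F C, F ∈ FF /\ fiber V F /\ app f F C /\
    forall t, t ∈ u <-> exists p z, p ∈ C /\ is_pair p V z /\ t ∈ z).
  destruct (relation_exists U Z R) as (r & _ & Hr);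
    [unfold R, fiber; definable|].
  (* Outer union, over the countable set [U]. *)
  destruct (sigma_ideal_union X Z U r HZ HU) as (u & HuZ & Hu).
  - intros V a _ H. apply Hr in H. tauto.
  - intros V a a' _ H H'. apply Hr in H. apply Hr in H'.
    destruct H as (_ & _ & F & C & HF & HVF & HC & Ha).
    destruct H' as (_ & _ & F' & C' & HF' & HVF' & HC' & Ha').
    assert (F = F').
    { apply (zf_extensionality HM). intros p. rewrite (HVF p), (HVF' p). reflexivity. }
    subst F'. rewrite <- (app_unique f FF F C C' Hf HC HC') in Ha'.
    apply (zf_extensionality HM). intros t. rewrite (Ha t), (Ha' t). reflexivity.
  - exists u. split; [exact HuZ|]. split.
    + intros t Ht. apply Hu in Ht. destruct Ht as (V & a & HV & Ha & Ht).
      apply Hr in Ha. destruct Ha as (_ & _ & F & C & HF & HVF & HC & Ha).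
      apply Ha in Ht. destruct Ht as (p & z & Hp & Hpz & Ht).
      destruct (HfC F C HF HC) as (_ & HCF & _). apply HCF, HVF in Hp.
      destruct Hp as (z' & _ & Hgz' & Hpz').
      destruct (pair_inj _ _ _ _ _ Hpz Hpz') as [_ <-]. eauto.
    + intros V HV. destruct (fiber_exists V HV) as (F & HF & HVF).
      destruct (app_exists f FF F Hf HF) as [C HC].
      destruct (HfC F C HF HC) as ([p Hp] & HCF & HCc).
      destruct (relation_exists C Z (fun q z => is_pair q V z) ltac:(definable))
        as (r' & _ & Hr').
      (* Inner union, over the countable set [C] of tagged witnesses for a single V; it shows that V
         is in the domain of [r]. *)
      destruct (sigma_ideal_union X Z C r' HZ HCc) as (v & HvZ & Hv).
      { intros q a _ H. apply Hr' in H. tauto. }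
      { intros q a a' _ H H'. apply Hr' in H. apply Hr' in H'.
        apply (pair_inj q V a V a'); tauto. }
      destruct (proj1 (HVF p) (HCF p Hp)) as (z & Hz & Hgz & Hpz).
      exists z. split; [exact Hgz|]. intros t Ht. apply Hu. exists V, v.
      split; [exact HV|]. split.
      * apply Hr. split; [exact HV|]. split; [exact HvZ|]. exists F, C.
        split; [exact HF|]. split; [exact HVF|]. split; [exact HC|].
        intros x. rewrite (Hv x). split.
        -- intros (q & a & Hq & Hqa & Hx). apply Hr' in Hqa. exists q, a. tauto.
        -- intros (q & a & Hq & Hqa & Hx). exists q, a.
           split; [exact Hq|]. split; [|exact Hx]. apply Hr'.
           split; [exact Hq|]. split; [|exact Hqa].
           pose proof (HCF q Hq) as Hq'. apply HVF in Hq'.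
           destruct Hq' as (a' & Ha' & _ & Hqa').
           now destruct (pair_inj _ _ _ _ _ Hqa Hqa') as [_ <-].
      * apply Hv. exists p, z. split; [exact Hp|]. split; [|exact Ht].
        apply Hr'. tauto.
Qed.

(** * Topologies given by basic neighbourhoods *)

Lemma topology_iff (Y Open Open' : M -> Prop) :
  (forall V, Open V <-> Open' V) -> topology Y Open -> topology Y Open'.
Proof.
  intros HO (H1 & (E & HE & HE') & (V & HV & HV') & H4 & H5).
  split; [|split; [|split; [|split]]].
  - intros W HW. apply H1. now apply HO.
  - exists E. split; [now apply HO|exact HE'].
  - exists V. split; [now apply HO|exact HV'].
  - intros W W' HW HW'. destruct (H4 W W') as (G & HG & HG'); try now apply HO.
    exists G. split; [now apply HO|exact HG'].
  - intros S HS. destruct (H5 S) as (G & HG & HG').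
    + intros W HW. apply HO. auto.
    + exists G. split; [now apply HO|exact HG'].
Qed.

Lemma P_space_iff (Y Open Open' : M -> Prop) :
  (forall V, Open V <-> Open' V) -> P_space Y Open -> P_space Y Open'.
Proof.
  intros HO [Ht HG]. split; [exact (topology_iff Y Open Open' HO Ht)|].
  intros G (U & HU & HUO & HGU). apply HO, HG. exists U.
  split; [exact HU|]. split; [|exact HGU]. intros V HV. apply HO. auto.
Qed.

(* [N z x y] says that y is in the basic neighbourhood of x given by z, which is
   considered only when [adm z x]. *)
Definition nbhd_open (Y : M -> Prop) (Z : M) (adm : M -> M -> Prop)
    (N : M -> M -> M -> Prop) (V : M) : Prop :=
  (forall x, x ∈ V -> Y x) /\
  forall x, x ∈ V -> exists z, z ∈ Z /\ adm z x /\
    forall y, Y y -> N z x y -> y ∈ V.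

(** Phrased by covering, so that it gives at once the empty set, binary unions and the large union
    produced by the choice argument. *)
Definition adm_union_closed (adm : M -> M -> Prop) : Prop :=
  forall x u, (forall t, t ∈ u -> exists a, adm a x /\ t ∈ a) -> adm u x.

Definition nbhd_antitone (N : M -> M -> M -> Prop) : Prop :=
  forall a u x y, a ⊆ u -> N u x y -> N a x y.

(** The empty member of [Z] witnesses that the whole space is open; for an intersection of two open
    sets, the union of two witnesses is admissible and its neighbourhood lies in both. *)
Lemma nbhd_topology (X Z W : M) (Y : M -> Prop) (adm : M -> M -> Prop)
    (N : M -> M -> M -> Prop) :
  (forall x, x ∈ W <-> Y x) -> ideal X Z ->
  adm_union_closed adm -> nbhd_antitone N ->
  topology Y (nbhd_open Y Z adm N).
Proof.
  intros HW (_ & (o & Ho & HoZ) & _ & HZU) Hadm HN.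
  split; [|split; [|split; [|split]]].
  - intros V [HV _]. exact HV.
  - exists o. split; [|exact Ho]. split; intros x Hx; now destruct (Ho x).
  - exists W. split; [|exact HW]. split; [intros x; apply HW|].
    intros x _. exists o. split; [exact HoZ|]. split.
    + apply Hadm. intros t Ht. now destruct (Ho t).
    + intros y Hy _. now apply HW.
  - intros V V' [HV HVn] [HV' HVn'].
    destruct (separation (fun x => x ∈ V') V ltac:(definable)) as [I HI].
    exists I. split; [|exact HI]. split; [intros x Hx; apply HI in Hx; now apply HV|].
    intros x Hx. apply HI in Hx. destruct Hx as [Hx Hx'].
    destruct (HVn x Hx) as (z & Hz & Hzx & Hzn).
    destruct (HVn' x Hx') as (z' & Hz' & Hzx' & Hzn').
    destruct (HZU z z' Hz Hz') as (u & Hu & Hzu). exists u. split; [exact Hu|]. split.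
    + apply Hadm. intros t Ht. apply Hzu in Ht. destruct Ht; eauto.
    + intros y Hy HNy. apply HI. split.
      * apply Hzn; [exact Hy|]. apply (HN z u); [|exact HNy].
        intros t Ht. apply Hzu. auto.
      * apply Hzn'; [exact Hy|]. apply (HN z' u); [|exact HNy].
        intros t Ht. apply Hzu. auto.
  - intros S HS. destruct (zf_union HM S) as [U HU]. exists U. split; [|exact HU].
    split.
    + intros x Hx. apply HU in Hx. destruct Hx as (V & HV & Hx).
      exact (proj1 (HS V HV) x Hx).
    + intros x Hx. apply HU in Hx. destruct Hx as (V & HV & Hx).
      destruct (proj2 (HS V HV) x Hx) as (z & Hz & Hzx & Hzn).
      exists z. split; [exact Hz|]. split; [exact Hzx|].
      intros y Hy HNy. apply HU. eauto.
Qed.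

Lemma nbhd_P_space (X Z W : M) (Y : M -> Prop) (adm : M -> M -> Prop)
    (N : M -> M -> M -> Prop) :
  CMC M -> sigma_ideal X Z -> (forall x, x ∈ W <-> Y x) ->
  adm_union_closed adm -> nbhd_antitone N ->
  (forall x, definable (fun e => adm (e 0) x)) ->
  (forall x, definable (fun e => N (e 1) x (e 0))) ->
  P_space Y (nbhd_open Y Z adm N).
Proof.
  intros HCMC HZ HW Hadm HN Dadm DN. split.
  - exact (nbhd_topology X Z W Y adm N HW (proj1 HZ) Hadm HN).
  - intros G (U & HU & HUO & HG). split; [intros x Hx; apply HG, Hx|].
    intros x Hx. apply HG in Hx. destruct Hx as [Hx HxU].
    specialize (Dadm x). specialize (DN x).
    (* The set [W] replaces the class [Y] in the formula, since [Y] is an arbitrary predicate while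
       membership in [W] is definable. *)
    destruct (relation_exists U Z
      (fun V z => adm z x /\ forall y, y ∈ W -> N z x y -> y ∈ V) ltac:(definable))
      as (g & _ & Hg).
    destruct (CMC_sigma_ideal X Z U g HCMC HZ HU) as (u & Hu & Hua & HuV).
    { intros V HV. destruct (proj2 (HUO V HV) x (HxU V HV)) as (z & Hz & Hzx & Hzn).
      exists z. split; [exact Hz|]. apply Hg. repeat split; try assumption.
      intros y Hy. apply Hzn. now apply HW. }
    exists u. split; [exact Hu|]. split.
    + apply Hadm. intros t Ht. destruct (Hua t Ht) as (V & a & _ & Ha & Hta).
      apply Hg in Ha. exists a. tauto.
    + intros y Hy HNy. apply HG. split; [exact Hy|]. intros V HV.
      destruct (HuV V HV) as (a & Ha & Hau). apply Hg in Ha.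
      destruct Ha as (_ & _ & _ & Hn). apply Hn; [now apply HW|].
      exact (HN a u x y Hau HNy).
Qed.

(** * The three spaces *)

Definition S_adm (z x : M) : Prop := disjoint x z.

Definition S_nbhd (X z x y : M) : Prop :=
  x ⊆ y /\ forall t, t ∈ y -> t ∈ X /\ t ∉ z.

Lemma S_open_iff (A : M -> Prop) (X Z V : M) :
  nbhd_open A Z S_adm (S_nbhd X) V <-> S_open A X Z V.
Proof.
  split; intros [HV HVn]; (split; [exact HV|]); intros x Hx;
    destruct (HVn x Hx) as (z & Hz & Hzx & Hn); exists z;
    (split; [exact Hz|]); (split; [exact Hzx|]); intros y Hy.
  - intros Hxy Hyz. apply Hn; [exact Hy|]. now split.
  - intros [Hxy Hyz]. now apply Hn.
Qed.

Lemma S_adm_union_closed : adm_union_closed S_adm.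
Proof.
  intros x u Hu t [Htx Htu]. destruct (Hu t Htu) as (a & Ha & Hta).
  apply (Ha t). now split.
Qed.

Lemma S_nbhd_antitone (X : M) : nbhd_antitone (S_nbhd X).
Proof.
  intros a u x y Hau [Hxy Hy]. split; [exact Hxy|]. intros t Ht.
  destruct (Hy t Ht) as [HtX Htu]. split; [exact HtX|]. intros Hta. now apply Htu, Hau.
Qed.

Lemma S_topology (A : M -> Prop) (X Z W : M) :
  (forall x, x ∈ W <-> A x) -> ideal X Z -> topology A (S_open A X Z).
Proof.
  intros HW HZ. apply (topology_iff A (nbhd_open A Z S_adm (S_nbhd X))).
  - apply S_open_iff.
  - exact (nbhd_topology X Z W A _ _ HW HZ S_adm_union_closed (S_nbhd_antitone X)).
Qed.

Lemma S_P_space (A : M -> Prop) (X Z W : M) :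
  CMC M -> sigma_ideal X Z -> (forall x, x ∈ W <-> A x) ->
  P_space A (S_open A X Z).
Proof.
  intros HCMC HZ HW. apply (P_space_iff A (nbhd_open A Z S_adm (S_nbhd X))).
  - apply S_open_iff.
  - apply (nbhd_P_space X Z W); try assumption.
    + apply S_adm_union_closed.
    + apply S_nbhd_antitone.
    + intros x. unfold S_adm. definable.
    + intros x. unfold S_nbhd. definable.
Qed.

Lemma infinite_nonempty (X : M) : infinite X -> nonempty X.
Proof.
  intros Hinf. destruct (classic (nonempty X)) as [H|H]; [exact H|].
  assert (HX : is_empty X) by (intros x Hx; apply H; now exists x).
  (* An empty X is itself the natural number 0, and also the empty bijection from X onto 0. *)
  destruct Hinf. exists X, X. split.
  - intros w [(e & He & Hew) _]. replace X with e; [exact Hew|].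
    apply (zf_extensionality HM). intros x. split; intros Hx.
    + now destruct (He x).
    + now destruct (HX x).
  - assert (Happ : forall x y, ~ app X x y) by (intros x y (p & _ & Hp); now destruct (HX p)).
    split; [split; [split|]|split].
    + intros p Hp. now destruct (HX p).
    + intros x Hx. now destruct (HX x).
    + intros x y Hxy. now destruct (Happ x y).
    + intros x x' y Hxy. now destruct (Happ x y).
    + intros y Hy. now destruct (HX y).
Qed.

Lemma two_power_exists (X : M) : exists W, forall f, f ∈ W <-> two_power X f.
Proof.
  assert (Hb : exists b : M, forall i, two i -> i ∈ b).
  { destruct (zf_infinity HM) as [w [(o & Ho & _) _]].
    (* [o] is 0, [i] = {0} is 1, and [b] = {0, 1} turns the class [two] into a set. *)
    destruct (zf_pairing HM o o) as [i Hi], (zf_pairing HM o i) as [b Hb].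
    assert (Ho' : forall j, is_empty j -> j = o).
    { intros j Hj. apply (zf_extensionality HM). intros x. split; intros Hx.
      - now destruct (Hj x).
      - now destruct (Ho x). }
    exists b. intros k [Hk|Hk]; apply Hb; [left; auto|right].
    apply (zf_extensionality HM). intros j. rewrite (Hk j), (Hi j). split.
    - intros Hj. left. auto.
    - intros [->| ->]; exact Ho. }
  destruct Hb as [b Hb], (product_exists X b) as [Xb HXb], (zf_power HM Xb) as [P HP].
  destruct (separation (two_power X) P) as [W HW]; [unfold two_power; definable|].
  exists W. intros f. rewrite (HW f). split; [tauto|]. intros Hf. split; [|exact Hf].
  apply HP. intros p Hp. destruct Hf as [[Hf _] Hf2].
  destruct (Hf p Hp) as (x & y & Hx & Hxy). apply HXb. exists x, y.
  split; [exact Hx|]. split; [|exact Hxy]. apply Hb, (Hf2 x). now exists p.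
Qed.

Lemma restriction_exists (X z f : M) :
  two_power X f -> z ⊆ X ->
  exists p, two_power z p /\ p ⊆ f /\
    forall x y, x ∈ z -> app f x y -> app p x y.
Proof.
  intros [Hf Hf2] Hz.
  destruct (separation (fun q => exists x y, x ∈ z /\ is_pair q x y) f
    ltac:(definable)) as [p Hp].
  assert (Hpf : p ⊆ f) by (intros q Hq; now apply Hp in Hq).
  assert (Happ : forall x y, app p x y -> app f x y).
  { intros x y (q & Hq & Hqp). exists q. auto. }
  assert (Happ' : forall x y, x ∈ z -> app f x y -> app p x y).
  { intros x y Hx (q & Hq & Hqf). exists q. split; [exact Hq|]. apply Hp. eauto. }
  exists p. split; [|now split]. split; [split|].
  - intros q Hq. apply Hp in Hq. tauto.
  - intros x Hx. destruct (proj2 Hf x (Hz x Hx)) as (y & Hy & Hu). exists y.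
    split; [auto|]. intros y' Hy'. auto.
  - intros x y Hxy. apply (Hf2 x). auto.
Qed.

Definition agree (z f g : M) : Prop :=
  forall x y, x ∈ z -> app f x y -> app g x y.

(** A cylinder containing f is determined by the domain z of p, as p must be the restriction of f to
    z; belonging to it means agreeing with f on z. Every z is therefore admissible for every f. *)
Lemma two_power_open_iff (X Z V : M) :
  ideal X Z -> (exists z, z ∈ Z /\ nonempty z) ->
  nbhd_open (two_power X) Z (fun _ _ => True) agree V <-> two_power_open X Z V.
Proof.
  intros (HZX & _ & _ & HZU) (z0 & Hz0 & s & Hs).
  split; intros [HV HVn]; (split; [exact HV|]); intros f Hf.
  - destruct (HVn f Hf) as (z & Hz & _ & Hn).
    (* Adding the non-empty [z0] ensures a non-empty domain; agreement on the larger u implies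
       agreement on z. *)
    destruct (HZU z z0 Hz Hz0) as (u & Hu & Huz).
    destruct (restriction_exists X u f (HV f Hf) (HZX u Hu)) as (p & Hp & Hpf & Hfp).
    exists u, p. split; [exact Hu|].
    split; [exists s; apply Huz; now right|]. split; [exact Hp|].
    split; [split; [now apply HV|exact Hpf]|].
    intros g [Hg Hpg]. apply Hn; [exact Hg|]. intros x y Hx Hxy.
    destruct (Hfp x y (proj2 (Huz x) (or_introl Hx)) Hxy) as (q & Hq & Hqp).
    exists q. auto.
  - destruct (HVn f Hf) as (z & p & Hz & _ & [[Hp _] _] & [_ Hpf] & Hn).
    exists z. split; [exact Hz|]. split; [exact I|].
    intros g Hg Hfg. apply Hn. split; [exact Hg|]. intros q Hq.
    destruct (Hp q Hq) as (x & y & Hx & Hxy).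
    destruct (Hfg x y Hx) as (q' & Hq' & Hqg); [exists q; auto|].
    now rewrite (pair_unique q q' x y Hxy Hq').
Qed.

Lemma two_power_P_space (X Z : M) :
  CMC M -> sigma_ideal X Z -> (exists z, z ∈ Z /\ nonempty z) ->
  P_space (two_power X) (two_power_open X Z).
Proof.
  intros HCMC HZ Hz. destruct (two_power_exists X) as [W HW].
  apply (P_space_iff _ (nbhd_open (two_power X) Z (fun _ _ => True) agree)).
  - intros V. exact (two_power_open_iff X Z V (proj1 HZ) Hz).
  - apply (nbhd_P_space X Z W); try assumption.
    + intros x u _. exact I.
    + intros a u f g Hau Hfg x y Hx. apply Hfg. auto.
    (* The admissibility condition is constantly true, which is expressed by the formula ⊥ → ⊥. *)
    + intros _. intros [x]. exists (FImp FFalse FFalse), (fun _ => x).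
      intros e. simpl. tauto.
    + intros f. unfold agree. definable.
Qed.

(** * Passing from all subsets of X to the finite ones *)

Lemma finite_subsets_exists (X : M) :
  exists W, forall x, x ∈ W <-> finite_subsets X x.
Proof.
  destruct (zf_power HM X) as [P HP].
  destruct (separation (@finite M) P ltac:(definable)) as [W HW].
  exists W. intros x. rewrite (HW x), (HP x). reflexivity.
Qed.

Lemma S_P_space_subspace (A : M -> Prop) (X Z W : M) :
  (forall x, x ∈ W <-> A x) -> (forall x, A x -> x ⊆ X) -> ideal X Z ->
  P_space (power_set X) (S_open (power_set X) X Z) ->
  P_space A (S_open A X Z).
Proof.
  intros HW HAX HZ [_ HP]. split; [exact (S_topology A X Z W HW HZ)|].
  intros G (U & (j & [Hj Hjw] & Hinj) & HUO & HG).
  destruct (zf_power HM X) as [PX HPX], (zf_power HM PX) as [PPX HPPX].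
  set (lift := fun V V' => forall y, y ∈ V' <-> y ⊆ X /\ exists z, z ∈ Z /\
    disjoint y z /\
    forall y', y' ∈ W -> y ⊆ y' -> (forall t, t ∈ y' -> t ∈ X /\ t ∉ z) -> y' ∈ V).
  assert (lift_exists : forall V, exists V', lift V V').
  { intros V. destruct (separation (fun y => exists z, z ∈ Z /\ disjoint y z /\
      forall y', y' ∈ W -> y ⊆ y' -> (forall t, t ∈ y' -> t ∈ X /\ t ∉ z) -> y' ∈ V) PX
      ltac:(definable)) as [V' HV'].
    exists V'. intros y. rewrite (HV' y), (HPX y). reflexivity. }
  assert (lift_trace : forall V V', S_open A X Z V -> lift V V' ->
    forall y, y ∈ V <-> A y /\ y ∈ V').
  { intros V V' [HVA HVn] HV' y. split.
    - intros Hy. split; [auto|]. apply HV'. split; [auto|].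
      destruct (HVn y Hy) as (z & Hz & Hzy & Hn). exists z.
      split; [exact Hz|]. split; [exact Hzy|].
      intros y' Hy'. apply Hn. now apply HW.
    - intros [HyA Hy]. apply HV' in Hy. destruct Hy as (HyX & z & Hz & Hzy & Hn).
      (* The condition defining the lift is applied to y' = y, which is disjoint from z. *)
      apply Hn; [now apply HW|intros t Ht; exact Ht|].
      intros t Ht. split; [auto|]. intros Htz. apply (Hzy t). now split. }
  assert (lift_open : forall V V', lift V V' -> S_open (power_set X) X Z V').
  { intros V V' HV'. split; [intros y Hy; apply HV' in Hy; apply Hy|].
    intros y Hy. apply HV' in Hy. destruct Hy as (HyX & z & Hz & Hzy & Hn).
    exists z. split; [exact Hz|]. split; [exact Hzy|].
    (* The same z serves for y1: any y' that includes y1 also includes y. *)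
    intros y1 Hy1 Hyy1 Hy1z. apply HV'. split; [exact Hy1|]. exists z.
    split; [exact Hz|]. split.
    - intros t [Ht Htz]. now apply (Hy1z t Ht).
    - intros y' Hy' Hy1y'. apply Hn; [exact Hy'|]. intros t Ht. auto. }
  destruct (separation (fun V' => exists V, V ∈ U /\ lift V V') PPX) as [U' HU'];
    [unfold lift; definable|].
  assert (HU'lift : forall V', V' ∈ U' <-> exists V, V ∈ U /\ lift V V').
  { intros V'. rewrite (HU' V'). split; [tauto|]. intros H. split; [|exact H].
    destruct H as (V & _ & HV). apply HPPX. intros y Hy. apply HPX, HV, Hy. }
  assert (HU'c : countable U').
  { apply (countable_intro U' (fun V' n => exists V, V ∈ U /\ lift V V' /\ app j V n)).
    - unfold lift. definable.
    - intros V' HV'. apply HU'lift in HV'. destruct HV' as (V & HV & HV').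
      destruct (app_exists j U V Hj HV) as [n Hn]. exists n.
      split; [exact (Hjw V n Hn)|]. eauto.
    - intros V' n n' _ (V & HV & HVV' & Hn) (V1 & HV1 & HV1V' & Hn').
      assert (V = V1).
      { apply (zf_extensionality HM). intros y.
        rewrite (lift_trace V V' (HUO V HV) HVV' y),
          (lift_trace V1 V' (HUO V1 HV1) HV1V' y). reflexivity. }
      subst V1. exact (app_unique j U V n n' Hj Hn Hn').
    - intros V' V1' n _ _ (V & _ & HV & Hn) (V1 & _ & HV1 & Hn1).
      rewrite (Hinj V1 V n Hn1 Hn) in HV1.
      apply (zf_extensionality HM). intros y. rewrite (HV y), (HV1 y). reflexivity. }
  (* [G'] is the intersection of the lifts, taken inside the power set of X; its trace on [A] is
     [G], also when the family is empty. *)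
  destruct (separation (fun y => forall V', V' ∈ U' -> y ∈ V') PX ltac:(definable))
    as [G' HG'].
  assert (HG'O : S_open (power_set X) X Z G').
  { apply HP. exists U'. split; [exact HU'c|]. split.
    - intros V' HV'. apply HU'lift in HV'. destruct HV' as (V & _ & HV). eauto.
    - intros y. rewrite (HG' y), (HPX y). reflexivity. }
  assert (HGG' : forall y, y ∈ G <-> A y /\ y ∈ G').
  { intros y. rewrite (HG y), (HG' y), (HPX y). split.
    - intros [Hy HyU]. split; [exact Hy|]. split; [auto|].
      intros V' HV'. apply HU'lift in HV'. destruct HV' as (V & HV & HVV').
      apply (lift_trace V V' (HUO V HV) HVV'). auto.
    - intros [Hy [_ HyU']]. split; [exact Hy|]. intros V HV.
      destruct (lift_exists V) as [V' HV']. apply (lift_trace V V' (HUO V HV) HV').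
      split; [exact Hy|]. apply HyU', HU'lift. eauto. }
  split; [intros y Hy; apply HGG' in Hy; tauto|].
  intros y Hy. apply HGG' in Hy. destruct Hy as [HyA Hy].
  destruct (proj2 HG'O y Hy) as (z & Hz & Hzy & Hn). exists z.
  split; [exact Hz|]. split; [exact Hzy|].
  intros y' Hy' Hyy' Hy'z. apply HGG'. split; [exact Hy'|].
  apply Hn; [exact (HAX y' Hy')|exact Hyy'|exact Hy'z].
Qed.

End Model.

Theorem theorem4p12 (M : set_structure) (HM : is_ZF_model M) :
  (CMC M -> P_spaces_two_power_and_SP M) /\
  (P_spaces_two_power_and_SP M -> P_spaces_S M).
Proof.
  split.
  - intros HCMC X Z Hinf [_ HXZ] HZ. split.
    + apply (two_power_P_space HM X Z HCMC HZ).
      (* Since [Z] covers the non-empty X, some member of [Z] is non-empty and can serve as the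
         domain of a cylinder. *)
      destruct (infinite_nonempty HM X Hinf) as [x Hx]. apply HXZ in Hx.
      destruct Hx as (z & Hz & Hx). exists z. split; [exact Hz|]. now exists x.
    + destruct (zf_power HM X) as [W HW].
      exact (S_P_space HM (power_set X) X Z W HCMC HZ HW).
  - intros Hb X Z Hinf HXZ HZ. destruct (Hb X Z Hinf HXZ HZ) as [_ HP].
    destruct (finite_subsets_exists HM X) as [W HW].
    apply (S_P_space_subspace HM (finite_subsets X) X Z W HW); [|exact (proj1 HZ)|exact HP].
    now intros x [Hx _].
Qed.
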